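(* Let $G=(V,E)$ be an undirected connected graph, and let $S\subset V$ with $|S|=3$. Then $S$ is not a minimal perfect critical vertex set of $G$.
   Context: Graphs are finite, simple, undirected, unweighted. $\mathbf{L}$ denotes the Laplacian matrix of $G$ (degree matrix minus adjacency matrix). For $S\subset V$, $\overline{S}=V\setminus S$. For a vector $\mathbf{y}$ indexed by $V$, $\mathbf{y}|_S$ is the restriction of $\mathbf{y}$ to the coordinates in $S$. A nonempty $S\subset V$ is a critical vertex set if there is an eigenvector $\mathbf{y}$ of $\mathbf{L}$ with $\mathbf{y}|_{\overline S}=\mathbf{0}$. It is a perfect critical vertex set if there is an eigenvector $\mathbf{y}$ of $\mathbf{L}$ with $\mathbf{y}|_{\overline S}=\mathbf{0}$ and $\mathbf{y}|_{\{v\}}\neq 0$ for every $v\in S$. ($S=V$ is allowed.) A perfect critical vertex set is minimal if no proper subset of it is a perfect critical vertex set. *)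

(* Defs.v *)
From HB Require Import structures.
From mathcomp Require Import all_boot all_order all_algebra.
From mathcomp Require Import reals.

Set Implicit Arguments.
Unset Strict Implicit.
Unset Printing Implicit Defensive.

Import Order.TTheory GRing.Theory Num.Theory.
Local Open Scope ring_scope.

Record sgraph := SGraph {
  vertex :> finType;
  edge : rel vertex;
  edge_sym : symmetric edge;
  edge_irrefl : irreflexive edge }.

Definition connected_graph (G : sgraph) : Prop :=
  forall u v : G, connect (@edge G) u v.

Definition degree (G : sgraph) (v : G) : nat := #|[set u : G | edge v u]|.

(* Rows and columns are indexed by 'I_#|G|; the index i stands for the vertex
   enum_val i, and the vertex v has index enum_rank v. *)
Definition degree_mx (R : realType) (G : sgraph) : 'M[R]_#|G| :=
  diag_mx (\row_i (degree (enum_val i : G))%:R).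

Definition adjacency_mx (R : realType) (G : sgraph) : 'M[R]_#|G| :=
  \matrix_(i, j) (edge (enum_val i : G) (enum_val j))%:R.

Definition laplacian (R : realType) (G : sgraph) : 'M[R]_#|G| :=
  degree_mx R G - adjacency_mx R G.

Definition vcoord (R : realType) (G : sgraph) (y : 'cV[R]_#|G|) (v : G) : R :=
  y (enum_rank v) 0.

(* The library's eigenspace consists of row vectors; these are the usual
   (column) eigenvectors. *)
Definition is_eigenvector (R : realType) (n : nat) (A : 'M[R]_n)
    (y : 'cV[R]_n) : Prop :=
  y != 0 /\ exists a : R, A *m y = a *: y.

Definition perfect_critical (R : realType) (G : sgraph) (S : {set G}) : Prop :=
  S != set0 /\
  exists y : 'cV[R]_#|G|,
    [/\ is_eigenvector (laplacian R G) y,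
        forall v : G, v \in ~: S -> vcoord y v = 0
      & forall v : G, v \in S -> vcoord y v != 0].

Definition minimal_perfect_critical (R : realType) (G : sgraph)
    (S : {set G}) : Prop :=
  perfect_critical R S /\
  forall S' : {set G}, S' \proper S -> ~ perfect_critical R S'.

(* Main.v *)
(** Let [y] be an eigenvector supported exactly on [S].  Either its eigenvalue
    is nonzero, and then [y] is orthogonal to the all-ones vector, or [y] is
    constant and [S = V].  In the first case every vertex outside [S] is adjacent to
    all or to none of the three vertices of [S]: one or two neighbours in [S]
    would force a coordinate of [y] on [S] to vanish.  Among three vertices, two
    are related in the same way to the third, so [S] contains two twins [a] and
    [b]; then [e_a - e_b] is an eigenvector and [{a, b}] is perfect critical. *)
Require Import Defs.
From HB Require Import structures.
From mathcomp Require Import all_boot all_order all_algebra.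
From mathcomp Require Import reals.
From mathcomp Require Import ring lra.

Set Implicit Arguments.
Unset Strict Implicit.
Unset Printing Implicit Defensive.

Import Order.TTheory GRing.Theory Num.Theory.
Local Open Scope ring_scope.

(** The Laplacian as an operator on functions. Written with differences, its terms visibly change
    sign when [u] and [v] are swapped, and have constant sign when [v] is a maximum. *)
Definition lap_fun (R : realType) (G : sgraph) (f : G -> R) (v : G) : R :=
  \sum_(u : G) (edge v u)%:R * (f v - f u).

(** No condition bears on the pair [a], [b] itself, so adjacent and nonadjacent twins are treated
    together. *)
Definition adjacency_twins (G : sgraph) (a b : G) : Prop :=
  forall v : G, v != a -> v != b -> edge v a = edge v b.

Lemma lap_funE (R : realType) (G : sgraph) (f : G -> R) (v : G) :
  lap_fun f v = (degree v)%:R * f v - \sum_u (edge v u)%:R * f u.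
Proof.
rewrite /lap_fun; under eq_bigr do rewrite mulrBr.
rewrite sumrB -mulr_suml; congr (_ * _ - _).
by rewrite -natr_sum /degree cardsE -sum1_card [in RHS]big_mkcond;
  congr _%:R; apply: eq_bigr => u _; rewrite unfold_in; case: edge.
Qed.

Lemma vcoord_laplacian (R : realType) (G : sgraph) (y : 'cV[R]_#|G|) (v : G) :
  vcoord (laplacian R G *m y) v = lap_fun (vcoord y) v.
Proof.
rewrite lap_funE /vcoord /laplacian mulmxBl !mxE; congr (_ - _).
  rewrite (bigD1 (enum_rank v)) //= big1 ?addr0 => [|j jNv].
    by rewrite !mxE eqxx enum_rankK mulr1n.
  by rewrite !mxE eq_sym (negbTE jNv) mulr0n mul0r.
rewrite (reindex _ (onW_bij _ (enum_rank_bij G))) /=.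
by apply: eq_bigr => u _; rewrite !mxE !enum_rankK.
Qed.

Lemma laplacian_eigenP (R : realType) (G : sgraph) (y : 'cV[R]_#|G|) (l : R) :
  laplacian R G *m y = l *: y <->
  forall v, lap_fun (vcoord y) v = l * vcoord y v.
Proof.
split=> [Ly v|Ly]; first by rewrite -vcoord_laplacian Ly /vcoord mxE.
apply/matrixP => i j; rewrite ord1.
have := Ly (enum_val i); rewrite -vcoord_laplacian /vcoord enum_valK => ->.
by rewrite mxE.
Qed.

(** Swapping the two ends of each edge negates the double sum, which is therefore its own
    opposite. *)
Lemma sum_lap_fun (R : realType) (G : sgraph) (f : G -> R) :
  \sum_v lap_fun f v = 0.
Proof.
have /eqP : \sum_v lap_fun f v = - \sum_v lap_fun f v.
  rewrite {1}exchange_big /= -sumrN; apply: eq_bigr => v _.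
  rewrite -sumrN; apply: eq_bigr => u _.
  by rewrite edge_sym -mulrN opprB.
by rewrite -addr_eq0 -mulr2n mulrn_eq0 /= => /eqP.
Qed.

(* Maximum principle: all neighbours of a maximum of [f] are maxima. *)
Lemma harmonic_constant (R : realType) (G : sgraph) (f : G -> R) :
  connected_graph G -> (forall v, lap_fun f v = 0) -> forall u v, f u = f v.
Proof.
move=> Gconn harm u0 v0.
case: (@arg_maxP _ _ _ u0 xpredT f isT) => m _ maxm.
have step x : f x = f m -> forall z, edge x z -> f z = f m.
  (* At a maximum all terms are nonnegative; as their sum is zero, each one vanishes. *)
  move=> fx z xz; move: (harm x) => /eqP; rewrite /lap_fun psumr_eq0.
    move=> /allP/(_ z (mem_index_enum _)); rewrite xz mul1r subr_eq0 fx.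
    by move=> /eqP.
  by move=> u _; rewrite mulr_ge0 ?ler0n // fx subr_ge0; apply: maxm.
suff const x : f x = f m by rewrite !const.
have /connectP[p] := Gconn m x.
elim: p m {maxm} step => [|z p IH] m step /= => [_ ->//|].
move=> /andP[mz zp] xE; have fz := step m erefl z mz.
by rewrite -fz; apply: IH zp xE => w; rewrite fz; apply: step.
Qed.

Lemma sum_supported3 (R : nmodType) (T : finType) (g : T -> R) (a b c : T) :
  a != b -> a != c -> b != c -> (forall v, v \notin [set a; b; c] -> g v = 0) ->
  \sum_v g v = g a + g b + g c.
Proof.
move=> ab ac bc g0.
rewrite (bigD1 a) //= (bigD1 b) 1?eq_sym //= (bigD1 c) /=; last first.
  by rewrite ![c == _]eq_sym ac bc.
rewrite big1 ?addr0 ?addrA // => v /andP[/andP[va vb] vc].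
by apply: g0; rewrite !inE !negb_or va vb vc.
Qed.

(** The neighbourhoods agree away from [a] and [b], and the possible edge between the two counts
    once on each side. *)
Lemma twins_degree (G : sgraph) (a b : G) :
  adjacency_twins a b -> degree a = degree b.
Proof.
move=> tw; have [->//|ab] := eqVneq a b.
rewrite /degree (cardsD1 b [set u | edge a u]) (cardsD1 a [set u | edge b u]).
rewrite !inE (edge_sym b a); congr (_ + _)%N; apply: eq_card => v.
rewrite !inE; have [->|va] := eqVneq v a; first by rewrite edge_irrefl andbF.
have [->|vb] /= := eqVneq v b; first by rewrite edge_irrefl.
by rewrite edge_sym tw // edge_sym.
Qed.

Lemma twins_perfect_critical (R : realType) (G : sgraph) (a b : G) :
  a != b -> adjacency_twins a b -> perfect_critical R [set a; b].
Proof.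
move=> ab tw; split; first by apply/set0Pn; exists a; rewrite !inE eqxx.
pose f v : R := (v == a)%:R - (v == b)%:R.
pose y : 'cV[R]_#|G| := \col_i f (enum_val i).
have yE v : vcoord y v = f v by rewrite /vcoord mxE enum_rankK.
have ba : (b == a) = false by rewrite eq_sym (negbTE ab).
have fa : f a = 1 by rewrite /f eqxx (negbTE ab) subr0.
have fb : f b = -1 by rewrite /f eqxx ba sub0r.
have f0 v : v != a -> v != b -> f v = 0.
  by move=> /negbTE va /negbTE vb; rewrite /f va vb subr0.
have sumE v : \sum_u (edge v u)%:R * f u = (edge v a)%:R - (edge v b)%:R.
  rewrite (bigD1 a) //= (bigD1 b) 1?eq_sym //= big1 => [|u /andP[ua ub]].
    by rewrite fa fb mulr1 mulrN1 addr0.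
  by rewrite f0 // mulr0.
exists y; split; first split.
- by apply/eqP => y0; have := yE a; rewrite fa y0 /vcoord mxE => /eqP;
    rewrite eq_sym oner_eq0.
(* The eigenvalue is read off at [a], where [f] is 1 and the only other contribution comes from [b],
   where [f] is -1. *)
- exists ((degree a)%:R + (edge a b)%:R); apply/laplacian_eigenP => v.
  rewrite lap_funE yE; under eq_bigr do rewrite yE.
  rewrite sumE; have [->|va] := eqVneq v a.
    by rewrite fa edge_irrefl mulr0n; ring.
  have [->|vb] := eqVneq v b.
    by rewrite fb edge_irrefl (edge_sym b a) (twins_degree tw) mulr0n; ring.
  by rewrite f0 // tw // subrr !mulr0 subr0.
- by move=> v; rewrite yE !inE negb_or => /andP[]; apply: f0.
- move=> v; rewrite yE !inE => /orP[]/eqP->; rewrite ?fa ?fb ?oppr_eq0;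
    exact: oner_neq0.
Qed.

Lemma minimal_no_twins (R : realType) (G : sgraph) (S : {set G}) (a b : G) :
  minimal_perfect_critical R S -> (2 < #|S|)%N -> a \in S -> b \in S -> a != b ->
  ~ adjacency_twins a b.
Proof.
move=> [_ minS] S3 aS bS ab /(twins_perfect_critical R ab); apply: minS.
by rewrite properEcard cards2 ab S3 subUset !sub1set aS bS.
Qed.

Lemma perfect_critical3_outside (R : realType) (G : sgraph) (a b c : G) :
  connected_graph G -> a != b -> a != c -> b != c ->
  perfect_critical R [set a; b; c] ->
  forall v, v \notin [set a; b; c] ->
    edge v a = edge v b /\ edge v b = edge v c.
Proof.
move=> Gconn ab ac bc [_ [y [[_ [l /laplacian_eigenP Ly]] y0 yN0]]] v vS.
set f := vcoord y in Ly y0 yN0.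
have {}y0 u : u \notin [set a; b; c] -> f u = 0 by rewrite -in_setC; apply: y0.
have fa : f a != 0 by apply: yN0; rewrite !inE eqxx.
have fb : f b != 0 by apply: yN0; rewrite !inE eqxx orbT.
have fc : f c != 0 by apply: yN0; rewrite !inE eqxx orbT.
have [l0|lN0] := eqVneq l 0.
  have harm w : lap_fun f w = 0 by rewrite Ly l0 mul0r.
  by move: fa; rewrite (harmonic_constant Gconn harm a v) y0 ?eqxx.
(* Sum the eigenvalue equation over all vertices and cancel the nonzero [l]. *)
have sum0 : f a + f b + f c = 0.
  rewrite -(sum_supported3 ab ac bc y0); apply: (mulfI lN0).
  rewrite mulr0 mulr_sumr -[RHS](sum_lap_fun f).
  by apply: eq_bigr => u _; rewrite Ly.
(* This is the eigenvalue equation at [v], where [f] vanishes. *)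
have nbr0 : (edge v a)%:R * f a + (edge v b)%:R * f b + (edge v c)%:R * f c = 0.
  rewrite -(@sum_supported3 _ _ (fun u => (edge v u)%:R * f u) _ _ _ ab ac bc).
    move: (Ly v); rewrite lap_funE y0 // !mulr0 sub0r => /eqP.
    by rewrite oppr_eq0 => /eqP.
  by move=> u /y0 ->; rewrite mulr0.
move/eqP: fa fb fc => fa /eqP fb /eqP fc.
(* A single neighbour contradicts [nbr0] at once. With exactly two, subtracting [nbr0] from [sum0]
   kills the value at the third vertex. *)
case: (edge v a) nbr0; case: (edge v b); case: (edge v c);
  rewrite ?mul1r ?mul0r ?add0r ?addr0 // => nbr0; exfalso.
- by apply: fc; lra.
- by apply: fb; lra.
- by apply: fa; lra.
Qed.

Local Close Scope ring_scope.

Lemma cards3_elements (T : finType) (S : {set T}) : #|S| = 3 ->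
  exists a b c, [/\ a != b, a != c, b != c & S = [set a; b; c]].
Proof.
move=> S3; have /set0Pn[c cS] : S != set0 by rewrite -card_gt0 S3.
have /eqP/cards2P[a [b [ab SE]]] : #|S :\ c| = 2.
  by move: S3; rewrite (cardsD1 c) cS => -[].
have : a \in S :\ c by rewrite SE !inE eqxx.
have : b \in S :\ c by rewrite SE !inE eqxx orbT.
rewrite !inE => /andP[bc _] /andP[ac _]; exists a, b, c; split=> //.
by rewrite -(setD1K cS) SE setUC.
Qed.

Theorem theorem2 (R : realType) (G : sgraph) (S : {set G})
  (Gconn : connected_graph G) (cardS : #|S| = 3) :
  ~ minimal_perfect_critical R S.
Proof.
move=> minS; have [a [b [c [ab ac bc SE]]]] := cards3_elements cardS.
have [critS _] := minS; rewrite SE in critS.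
have out := perfect_critical3_outside Gconn ab ac bc critS.
have noTwins x z := @minimal_no_twins R G S x z minS.
rewrite cardS SE in noTwins.
have [aS bS cS] : [/\ a \in S, b \in S & c \in S].
  by rewrite SE !inE !eqxx !orbT.
rewrite SE in aS bS cS.
(* Two of the three Booleans [edge a b], [edge a c], [edge b c] agree; the two pairs share a vertex,
   and the other two vertices are twins. *)
have [acbc|acNbc] := eqVneq (edge c a) (edge c b).
  apply: (noTwins a b) => // v va vb; have [->//|vc] := eqVneq v c.
  by have [] := out v; rewrite // !inE !negb_or va vb vc.
have [abcb|abNcb] := eqVneq (edge b a) (edge b c).
  apply: (noTwins a c) => // v va vc; have [->//|vb] := eqVneq v b.
  by have [|-> ->] := out v; rewrite // !inE !negb_or va vb vc.
apply: (noTwins b c) => // v vb vc; have [->|va] := eqVneq v a.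
  (* Both [edge a c] and [edge a b] differ from [edge b c], hence they are equal. *)
  move: acNbc abNcb; rewrite (edge_sym c a) (edge_sym b a) (edge_sym c b).
  by case: (edge a c); case: (edge a b); case: (edge b c).
by have [] := out v; rewrite // !inE !negb_or va vb vc.
Qed.
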